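(* Let $F$ be a graph with at least one edge and without isolated vertices, with $v$ vertices and $\ell$ edges, and let $c_F=\lim_{n\to\infty}\mathrm{wsat}(n,F)/n$. Then, for every integer $n\ge v$, $$\mathrm{wsat}(n,F)\ \ge\ c_F\,(n-v)+\ell-1.$$
   Context: All graphs are finite and simple. Given a graph $F$, an $F$-bootstrap percolation process is a sequence of graphs $H_0\subset H_1\subset\cdots\subset H_m$ on the same vertex set such that, for each $i=1,\ldots,m$, $H_i$ is obtained from $H_{i-1}$ by adding one edge that belongs to a copy of $F$ (a not necessarily induced subgraph isomorphic to $F$) in $H_i$. A graph $H$ on $[n]=\{1,\ldots,n\}$ is weakly $F$-saturated if there is an $F$-bootstrap percolation process $H=H_0\subset\cdots\subset H_m=K_n$. The number $\mathrm{wsat}(n,F)$ is the minimum number of edges of a weakly $F$-saturated graph on $[n]$. The limit $c_F=\lim_{n\to\infty}\mathrm{wsat}(n,F)/n$ is known to exist and to be finite for every such graph $F$ (Alon, 1985). *)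

(* Defs.v *)
From HB Require Import structures.
From mathcomp Require Import all_boot all_order all_algebra.
From mathcomp Require Import boolp classical_sets reals topology normedtype sequences.

Set Implicit Arguments.
Unset Strict Implicit.
Unset Printing Implicit Defensive.

Import Order.TTheory GRing.Theory Num.Theory.
Import numFieldNormedType.Exports.

(* Edges are two-element sets of vertices. *)
Record sgraph (V : finType) := SGraph {
  edges : {set {set V}};
  edges_card2 : [forall e in edges, #|e| == 2]
}.

HB.instance Definition _ (V : finType) := [isSub for @edges V].
HB.instance Definition _ (V : finType) := [Finite of sgraph V by <:].

Lemma complete_subproof (V : finType) :
  [forall e in [set e : {set V} | #|e| == 2], #|e| == 2].
Proof. by apply/forall_inP => e; rewrite inE. Qed.

Definition complete (V : finType) : sgraph V := SGraph (complete_subproof V).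

Definition no_isolated_vertex (V : finType) (F : sgraph V) : Prop :=
  forall x : V, exists2 e, e \in edges F & x \in e.

(* An injective f maps F onto a (not necessarily induced) copy of F in H. *)
Definition is_copy (V W : finType) (F : sgraph V) (H : sgraph W)
    (f : {ffun V -> W}) : bool :=
  injectiveb f && [forall e in edges F, f @: e \in edges H].

Definition bootstrap_step (V W : finType) (F : sgraph V) : rel (sgraph W) :=
  fun H H' => [exists e : {set W},
    [&& e \notin edges H, edges H' == e |: edges H &
        [exists f : {ffun V -> W},
          is_copy F H' f && (e \in [set f @: d | d : {set V} in edges F])]]].

(* The bootstrap percolation process H_0, ..., H_m is the list H_0 :: Hs. *)
Definition weakly_saturated (V W : finType) (F : sgraph V) (H : sgraph W) :
    Prop :=
  exists2 Hs : seq (sgraph W),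
    path (bootstrap_step F) H Hs & last H Hs = complete W.

Lemma complete_weakly_saturated (V W : finType) (F : sgraph V) :
  weakly_saturated F (complete W).
Proof. by exists [::]. Qed.

(* The minimum is over a nonempty family, by complete_weakly_saturated. *)
Definition wsat (n : nat) (V : finType) (F : sgraph V) : nat :=
  #|edges [arg min_(H < complete 'I_n | `[< weakly_saturated F H >])
             #|edges H|]|.

Lemma wsatP (n : nat) (V : finType) (F : sgraph V) :
  (exists2 H : sgraph 'I_n, weakly_saturated F H & #|edges H| = wsat n F) /\
  (forall H : sgraph 'I_n, weakly_saturated F H -> wsat n F <= #|edges H|).
Proof.
rewrite /wsat; case: arg_minnP => [|H /asboolP wH minH].
  by apply/asboolP; exact: complete_weakly_saturated.
by split=> [|H' wH']; [exists H | apply: minH; apply/asboolP].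
Qed.

Local Open Scope ring_scope.
Local Open Scope classical_set_scope.

(* [lim] is total, and is the genuine limit because the sequence converges
   whenever F has an edge (Alon, 1985); the junk quotient at n = 0 does not affect it. *)
Definition wsat_density (R : realType) (V : finType) (F : sgraph V) : R :=
  lim ((fun n : nat => (wsat n F)%:R / n%:R : R) @ \oo).

(* Main.v *)
Require Import Defs.
From mathcomp Require Import all_boot all_order all_algebra.
From mathcomp Require Import boolp reals.

(** Put g(k) = wsat(k + v, F) - (l - 1). A weakly saturated graph on at least v
  vertices contains l - 1 edges of some copy of F. Given optimal graphs on
  m + v and n + v vertices, glue them along v vertices so that the common part
  carries such a copy for the second graph, and drop those l - 1 edges from it:
  the first graph percolates and fills the common part, which restores the
  dropped edges, so the second one percolates too; a missing pair between the
  two sides is then completed by a copy of F with all other vertices in the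
  common part. Hence g >= 0 is subadditive, and by Fekete's lemma c_F exists
  and equals the infimum of g(k) / k. *)

Set Implicit Arguments.
Unset Strict Implicit.
Unset Printing Implicit Defensive.

(** * Graphs presented by sets of edges *)

Definition mkgraph (W : finType) (E : {set {set W}}) : sgraph W.
Proof.
by exists [set e in E | #|e| == 2]; apply/forall_inP => e; rewrite inE => /andP[].
Defined.

Lemma edges_mkgraph (W : finType) (E : {set {set W}}) e :
  (e \in edges (mkgraph E)) = (e \in E) && (#|e| == 2).
Proof. by rewrite inE. Qed.

Lemma card_mkgraph (W : finType) (E : {set {set W}}) :
  #|edges (mkgraph E)| <= #|E|.
Proof. by apply/subset_leq_card/subsetP => e; rewrite edges_mkgraph => /andP[]. Qed.

Lemma edge_card2 (W : finType) (H : sgraph W) e : e \in edges H -> #|e| = 2.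
Proof. by case: H => E EP /= eE; apply/eqP/(forall_inP EP). Qed.

Lemma edgeE (W : finType) (H : sgraph W) e : e \in edges H ->
  exists x y, x != y /\ e = [set x; y].
Proof.
by move=> eH; apply/cards2P/eqP/(edge_card2 eH).
Qed.

Lemma sgraph_inj (W : finType) (H H' : sgraph W) : edges H = edges H' -> H = H'.
Proof. exact: val_inj. Qed.

Lemma eq_complete (W : finType) (S : sgraph W) :
  (forall x y, x != y -> [set x; y] \in edges S) -> S = complete W.
Proof.
move=> Sxy; apply/sgraph_inj/setP => e; rewrite inE.
apply/idP/idP => [/edge_card2/eqP//|/cards2P[x [y [xy ->]]]].
exact: Sxy.
Qed.

(** * Weak saturation as a closure property *)

Definition bootstrap_closed (V W : finType) (F : sgraph V) (S : sgraph W) : Prop :=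
  forall (f : V -> W) (e : {set V}), injective f -> e \in edges F ->
    (forall d, d \in edges F -> d != e -> f @: d \in edges S) ->
    f @: e \in edges S.

(** Trades the existence of a process for a universal statement on closed graphs, so that later
    arguments handle no sequences of steps. *)
Lemma weakly_saturatedP (V W : finType) (F : sgraph V) (H : sgraph W) :
  weakly_saturated F H <->
  (forall S, edges H \subset edges S -> bootstrap_closed F S -> S = complete W).
Proof.
split=> [[Hs pHs lastHs] S HS clS|sat].
  apply: sgraph_inj; apply/eqP; rewrite eqEsubset; apply/andP; split.
    by apply/subsetP => e /edge_card2 e2; rewrite inE e2.
  rewrite -lastHs {lastHs}.
  (* The edge added by a step lies in a copy of [F] whose other edges are already present, hence in
     [S]; closedness puts it in [S] too. *)
  elim: Hs H HS pHs => //= H' Hs IH H HS /andP[step pHs].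
  apply: IH => //; case/existsP: step => e /and3P[_ /eqP H'E].
  move/existsP => [f /andP[/andP[/injectiveP finj /forall_inP fF]]].
  move/imsetP => [e0 e0F eE]; rewrite H'E subUset HS sub1set eE andbT.
  apply: clS => // d dF dne; have := fF _ dF.
  rewrite H'E !inE eE => /orP[/eqP /(imset_inj finj) de|].
    by rewrite de eqxx in dne.
  exact: (subsetP HS).
(* A graph reachable from [H] with the most edges is closed: a missing edge completing a copy would
   allow one more step. *)
have [M HM maxM] := arg_maxnP (fun M : sgraph W => #|edges M|)
  (connect0 (bootstrap_step F) H).
have HMs : edges H \subset edges M.
  case/connectP: HM => Hs pHs -> {maxM M sat}.
  elim: Hs H pHs => //= H' Hs IH H /andP[/existsP[e /and3P[_ /eqP H'E _]]] pHs.
  by apply: subset_trans (IH _ pHs); rewrite H'E subsetU1.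
case/connectP: (HM) => Hs pHs ME; exists Hs; rewrite -?ME => //.
apply: sat HMs _ => f e finj eF fF; apply: contraT => eM.
have fe2 : #|f @: e| == 2 by rewrite card_imset // (edge_card2 eF).
have [M' edgesM'] : exists M', edges M' = f @: e |: edges M.
  exists (mkgraph (f @: e |: edges M)); apply/setP => d; rewrite edges_mkgraph; apply: andb_idr.
  by case/setU1P => [->//|/edge_card2 ->].
have step : bootstrap_step F M M'.
  apply/existsP; exists (f @: e); rewrite eM edgesM' eqxx /=.
  apply/existsP; exists [ffun x => f x]; rewrite /is_copy edgesM' -andbA.
  have fE (d : {set V}) : [ffun x => f x] @: d = f @: d.
    by apply: eq_imset => x; rewrite ffunE.
  apply/and3P; split.
  - by apply/injectiveP => x y; rewrite !ffunE; apply: finj.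
  - apply/forall_inP => d dF; rewrite fE !inE.
    by have [->|/fF->//] := eqVneq d e; rewrite ?eqxx ?orbT.
  - by apply/imsetP; exists e.
have := maxM _ (connect_trans HM (connect1 step)).
by rewrite /= edgesM' cardsU1 eM ltnn.
Qed.

(** * Transport along injections of vertices *)

Definition pullback (U W : finType) (j : U -> W) (S : sgraph W) : sgraph U :=
  mkgraph [set e : {set U} | j @: e \in edges S].

Lemma edges_pullback (U W : finType) (j : U -> W) (S : sgraph W)
    (e : {set U}) :
  injective j -> (e \in edges (pullback j S)) = (j @: e \in edges S).
Proof.
move=> jinj; rewrite edges_mkgraph inE; apply: andb_idr => /edge_card2.
by rewrite card_imset // => ->.
Qed.

Lemma bootstrap_closed_pullback (V U W : finType) (F : sgraph V) (j : U -> W)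
    (S : sgraph W) :
  injective j -> bootstrap_closed F S -> bootstrap_closed F (pullback j S).
Proof.
move=> jinj clS f e finj eF fF; rewrite edges_pullback // -imset_comp.
apply: clS => // [|d dF dne]; first exact: inj_comp.
by rewrite imset_comp -edges_pullback //; exact: fF.
Qed.

(** Percolation inside an embedded copy of [H] fills that copy: the pullback of [S] is closed and
    contains [H], so it is complete. *)
Lemma weakly_saturated_pullback (V U W : finType) (F : sgraph V) (j : U -> W)
    (H : sgraph U) (S : sgraph W) :
  injective j -> weakly_saturated F H -> bootstrap_closed F S ->
  (forall e, e \in edges H -> j @: e \in edges S) ->
  forall x y, x != y -> [set j x; j y] \in edges S.
Proof.
move=> jinj /weakly_saturatedP sat clS HS x y xy.
have cP := bootstrap_closed_pullback jinj clS.
have /(sat _)/(_ cP) pE : edges H \subset edges (pullback j S).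
  by apply/subsetP => e eH; rewrite edges_pullback // HS.
rewrite -!imset_set1 -imsetU -edges_pullback // pE inE.
by rewrite cards2 xy.
Qed.

(** Lets [wsat], defined over ordinals, be bounded on any vertex type of the same size, such as the
    sum types used for gluing. *)
Lemma weakly_saturated_transfer (V U W : finType) (F : sgraph V) (H : sgraph U) :
  #|U| = #|W| -> weakly_saturated F H ->
  exists2 H' : sgraph W, weakly_saturated F H' & #|edges H'| <= #|edges H|.
Proof.
move=> UW wH; pose h x : W := enum_val (cast_ord UW (enum_rank x)).
have hinj : injective h.
  by move=> x y /enum_val_inj/cast_ord_inj/enum_rank_inj.
have hsur y : exists x, y = h x.
  by exists (enum_val (cast_ord (esym UW) (enum_rank y)));
    rewrite /h enum_valK cast_ordKV enum_rankK.
exists (mkgraph [set h @: e | e : {set U} in edges H]); last first.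
  exact: leq_trans (card_mkgraph _) (leq_imset_card _ _).
apply/weakly_saturatedP => S HS clS; apply: eq_complete => x' y'.
have [x ->] := hsur x'; have [y ->] := hsur y'.
rewrite (inj_eq hinj); apply: weakly_saturated_pullback wH clS _ _ _ => // e eH.
apply: (subsetP HS); rewrite edges_mkgraph imset_f //=.
by rewrite card_imset // (edge_card2 eH).
Qed.

Lemma wsat_exists (V W : finType) (F : sgraph V) :
  exists2 H : sgraph W, weakly_saturated F H & #|edges H| <= wsat #|W| F.
Proof.
have [[H wH <-] _] := wsatP #|W| F.
by apply: weakly_saturated_transfer wH; rewrite card_ord.
Qed.

Lemma wsat_min (V W : finType) (F : sgraph V) (H : sgraph W) :
  weakly_saturated F H -> wsat #|W| F <= #|edges H|.
Proof.
have cW : #|W| = #|'I_#|W| | by rewrite card_ord.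
move=> /(weakly_saturated_transfer cW)[H' wH']; apply: leq_trans.
by have [_] := wsatP #|W| F; apply.
Qed.

(* Either H is not closed, and some copy of F has at most one edge outside H, or
   H is complete and any copy will do. *)
Lemma weakly_saturated_almost_copy (V W : finType) (F : sgraph V)
    (H : sgraph W) :
  #|V| <= #|W| -> weakly_saturated F H ->
  exists2 f : V -> W, injective f &
    #|edges F|.-1 <= #|edges H :&: [set f @: d | d : {set V} in edges F]|.
Proof.
move=> VW /weakly_saturatedP/(_ H (subxx _)) sat.
have [clH|] := pselect (bootstrap_closed F H).
  pose f x : W := enum_val (widen_ord VW (enum_rank x)).
  have finj : injective f.
    by move=> x y /enum_val_inj/(congr1 val)/= /val_inj/enum_rank_inj.
  exists f => //; rewrite (sat clH) (setIidPr _) ?card_imset ?leq_pred//.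
    exact: imset_inj.
  apply/subsetP => _ /imsetP[d dF ->].
  by rewrite inE card_imset // (edge_card2 dF).
move/existsNP => [f] /existsNP[e] /not_implyP[finj] /not_implyP[eF].
move/not_implyP => [fF _]; exists f => //.
rewrite (cardsD1 e) eF -(card_imset _ (imset_inj finj)).
apply/subset_leq_card/subsetP => _ /imsetP[d + ->].
rewrite in_setD1 => /andP[de dF].
by rewrite inE imset_f // fF.
Qed.

(** * Gluing two weakly saturated graphs *)

Section Glue.
Variables (V X U : finType) (F : sgraph V) (f : V -> U).
Hypotheses (F_edge : 0 < #|edges F|) (f_inj : injective f).

(** In [X + U] the common part is the image of [f]: [glue_map] embeds the vertices of the first
    graph, [inr] those of the second. *)
Definition glue_map (x : (X + V)%type) : (X + U)%type :=
  match x with inl a => inl a | inr b => inr (f b) end.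

Lemma glue_map_inj : injective glue_map.
Proof. by move=> [x|x] [y|y] //= [] // => [->//|/f_inj->]. Qed.

Lemma bootstrap_closed_glue (S : sgraph (X + U)%type) : bootstrap_closed F S ->
  (forall x y, x != y -> [set glue_map x; glue_map y] \in edges S) ->
  (forall x y, x != y -> [set inr x; inr y] \in edges S) ->
  S = complete (X + U)%type.
Proof.
move=> clS SA SB.
have cross a u : [set inl a; inr u] \in edges S.
  have [/codomP[b ->]|ufN] := boolP (u \in codom f).
    exact: (SA (inl a) (inr b)).
  (* Put one edge of F across and every other vertex of F in the common part. *)
  case/card_gt0P: F_edge => e eF; have [p [q [pq eE]]] := edgeE eF.
  pose g z : (X + U)%type := if z == p then inl a else
    if z == q then inr u else inr (f z).
  have ufE z : (u == f z) = false.
    by apply: contraNF ufN => /eqP->; apply: codom_f.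
  have ginj : injective g.
    move=> y z; rewrite /g; have [->|yp] := eqVneq y p.
      by have [->|zp] := eqVneq z p; last by case: ifP.
    have [->|zp] := eqVneq z p; first by case: ifP.
    have [->|yq] := eqVneq y q; have [->|zq] := eqVneq z q => //.
    - by case=> /eqP; rewrite ufE.
    - by case=> /esym/eqP; rewrite ufE.
    - by case=> /f_inj.
  have -> : [set inl a; inr u] = g @: e.
    by rewrite eE imsetU !imset_set1 /g !eqxx eq_sym (negPf pq).
  apply: clS => // d dF; have [y [z [yz ->]]] := edgeE dF => de.
  rewrite imsetU !imset_set1.
  (* As [d] differs from [e], it does not join [p] to [q], so its image lies within one side. Taking
     [y != p] leaves only [z] as a possible preimage of [inl a]. *)
  wlog yp : y z yz de / y != p => [wl|].
    have [yp|yp] := eqVneq y p; last exact: wl.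
    rewrite setUC; apply: wl; first by rewrite eq_sym.
      by rewrite setUC.
    by rewrite -yp eq_sym.
  rewrite {1}/g (negPf yp); have [zp|zp] := eqVneq z p.
    rewrite /g zp eqxx ifF; first exact: (SA (inr y) (inl a)).
    by apply: contraNF de => /eqP->; rewrite zp eE setUC.
  rewrite /g (negPf zp); have [yq|yq] := eqVneq y q.
    by rewrite ifF ?SB ?ufE//; rewrite -yq eq_sym (negPf yz).
  by case: ifP => _; apply: SB; rewrite 1?eq_sym ?ufE // inj_eq // eq_sym.
apply: eq_complete => -[a|u] [b|w] xy //.
- exact: (SA (inl a) (inl b)).
- by rewrite setUC.
- exact: SB.
Qed.

Lemma weakly_saturated_glue (H1 : sgraph (X + V)%type) (H2 : sgraph U) :
  weakly_saturated F H1 -> weakly_saturated F H2 ->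
  weakly_saturated F (mkgraph
    ([set glue_map @: e | e : {set (X + V)%type} in edges H1] :|:
     [set inr @: e | e : {set U} in
        edges H2 :\: [set f @: d | d : {set V} in edges F]])).
Proof.
move=> w1 w2; apply/weakly_saturatedP => S HS clS.
have SA x y : x != y -> [set glue_map x; glue_map y] \in edges S.
  apply: (weakly_saturated_pullback glue_map_inj w1 clS) => e eH.
  apply: (subsetP HS); rewrite edges_mkgraph inE imset_f //=.
  by rewrite card_imset ?(edge_card2 eH) //; exact: glue_map_inj.
apply: bootstrap_closed_glue => //.
have inr_inj : injective (@inr X U) by move=> x y [].
apply: (weakly_saturated_pullback inr_inj w2 clS) => e eH.
(* A dropped edge of [H2] has both ends in the common part, which [SA] has already filled. *)
have [/imsetP[d dF ->]|eFN] :=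
  boolP (e \in [set f @: d | d : {set V} in edges F]).
  have [p [q [pq ->]]] := edgeE dF.
  by rewrite !imsetU !imset_set1; apply: (SA (inr p) (inr q)).
apply: (subsetP HS); rewrite edges_mkgraph inE; apply/andP; split.
  by apply/orP; right; apply: imset_f; rewrite inE eFN.
by rewrite card_imset // (edge_card2 eH).
Qed.

End Glue.

(** * Lower bound and subadditivity for [wsat] *)

Lemma wsat_ge_predn (V : finType) (F : sgraph V) n :
  #|edges F|.-1 <= wsat (n + #|V|) F.
Proof.
have [[H wH <-] _] := wsatP (n + #|V|) F.
have [|f _ fF] := weakly_saturated_almost_copy _ wH.
  by rewrite card_ord leq_addl.
exact: leq_trans fF (subset_leq_card (subsetIl _ _)).
Qed.

Lemma wsat_subadditive (V : finType) (F : sgraph V) m n :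
  0 < #|edges F| ->
  wsat (m + n + #|V|) F + #|edges F|.-1 <=
    wsat (m + #|V|) F + wsat (n + #|V|) F.
Proof.
move=> F_edge; have [H1] := wsat_exists ('I_m + V)%type F.
have [H2] := wsat_exists 'I_(n + #|V|) F.
rewrite card_sum !card_ord => w2 le2 w1 le1.
have [|f f_inj fF] := weakly_saturated_almost_copy _ w2.
  by rewrite card_ord leq_addl.
have := wsat_min (weakly_saturated_glue F_edge f_inj w1 w2).
rewrite card_sum !card_ord addnA => le12.
apply: leq_trans (leq_add le1 le2); apply: leq_trans (leq_add le12 fF) _.
(* The edges of [H2] split into those in the copy, at least [#|edges F|.-1] by [fF], and those kept
   in the glued graph. *)
rewrite -(cardsID [set f @: d | d : {set V} in edges F] (edges H2)).
rewrite [X in _ <= _ + X]addnC addnA leq_add2r.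
apply: leq_trans (card_mkgraph _) _; rewrite cardsU; apply: leq_trans (leq_subr _ _) _.
by apply: leq_add; apply: leq_imset_card.
Qed.

(* Fekete's lemma and the density bound *)
From mathcomp Require Import classical_sets topology normedtype sequences.
From mathcomp Require Import ring lra.
Import Order.TTheory GRing.Theory Num.Theory.
Import numFieldNormedType.Exports.
Local Open Scope ring_scope.
Local Open Scope classical_set_scope.

Lemma cvg_inv_addn (R : realType) (k : nat) :
  (n + k)%:R^-1 @[n --> \oo] --> (0 : R).
Proof.
have := (@cvg_shiftn k _ (fun n => n%:R^-1 : R) (nbhs (0 : R))); rewrite /= => ->.
by rewrite -cvg_shiftS; exact: cvg_harmonic.
Qed.

(** The limit is the infimum of [u k / k] over positive [k]. Dividing [n] by a nearly optimal [k]
    bounds [u n] by [n] times the ratio there, plus a constant. *)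
Lemma fekete (R : realType) (u : nat -> R) :
  (forall n, 0 <= u n) -> (forall m n, u (m + n)%N <= u m + u n) ->
  exists2 c : R, u n / n%:R @[n --> \oo] --> c &
    forall n, c * n%:R <= u n.
Proof.
move=> u_ge0 u_sub.
pose E := [set u n.+1 / n.+1%:R | n in setT].
have lbE : lbound E 0 by move=> _ [n _ <-]; apply: divr_ge0.
have infE : has_inf E by split; [exists (u 1 / 1%:R), 0 | exists 0].
have c_ge0 : 0 <= inf E by apply: lb_le_inf lbE; case: infE.
have c_le n : inf E * n%:R <= u n.
  case: n => [|n]; first by rewrite mulr0.
  rewrite -ler_pdivlMr ?ltr0n //; apply: ge_inf; first by exists 0.
  by exists n.
exists (inf E) => //; apply/cvgrPdist_lt => e e_gt0.
have e2_gt0 : 0 < e / 2 by rewrite divr_gt0.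
have [_ [k _ <-] k_lt] := inf_adherent e2_gt0 infE.
set c := inf E in c_ge0 c_le k_lt *; set q := u k.+1 / _ in k_lt.
(* Since [u] is nonnegative, [M] bounds its value at every remainder modulo [k.+1]. *)
pose M := \sum_(i < k.+1) u i.
have u_mul m r : u (m * k.+1 + r)%N <= m%:R * u k.+1 + u r.
  elim: m => [|m IH]; first by rewrite mul0n add0n mul0r add0r.
  rewrite mulSn -addnA; apply: le_trans (u_sub _ _) _.
  by rewrite -natr1 mulrDl mul1r; lra.
have u_le n : u n <= n%:R * q + M.
  rewrite {1}(divn_eq n k.+1); apply: le_trans (u_mul _ _) _.
  apply: lerD.
    rewrite /q mulrCA [leRHS]mulrC ler_wpM2r //.
    by rewrite ler_pdivlMr ?ltr0n // -natrM ler_nat leq_trunc_div.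
  rewrite /M (bigD1 (inord (n %% k.+1))) //= inordK ?ltn_pmod //.
  by rewrite lerDl sumr_ge0.
have M0 : M * (n + 0)%:R^-1 @[n --> \oo] --> (M * 0 : R).
  by apply: cvgM; [exact: cvg_cst | exact: cvg_inv_addn].
move: M0; rewrite mulr0 => /cvgrPdist_lt/(_ _ e2_gt0).
apply: filterS2 (nbhs_infty_gt 0) => n n_gt0.
rewrite addn0 sub0r normrN => /ltr_normlW Mn.
have n0 : 0 < n%:R :> R by rewrite ltr0n.
have cl : c <= u n / n%:R by rewrite ler_pdivlMr.
have : u n / n%:R <= q + M / n%:R.
  by rewrite ler_pdivrMr // mulrDl mulfVK ?gt_eqF // mulrC.
by move=> cu; rewrite distrC ger0_norm ?subr_ge0 //; lra.
Qed.

(** Fekete's lemma applies to [w (n + v) - b]; neither the shift nor the constant changes the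
    limiting ratio. *)
Lemma fekete_shift (R : realType) (w : nat -> R) (v : nat) (b : R) :
  (forall n, b <= w (n + v)%N) ->
  (forall m n, w (m + n + v)%N + b <= w (m + v)%N + w (n + v)%N) ->
  forall n, lim ((fun n => w n / n%:R) @ \oo) * n%:R + b <= w (n + v)%N.
Proof.
move=> w_ge w_sub.
have [||c wc c_le] := @fekete R (fun n => w (n + v)%N - b).
- by move=> n; rewrite subr_ge0.
- by move=> m n; have := w_sub m n; lra.
suff -> : lim ((fun n => w n / n%:R) @ \oo) = c.
  by move=> n; rewrite -lerBrDr.
apply: cvg_lim => //; rewrite -(@cvg_shiftn v _ _ (nbhs c)).
have kv := @cvg_inv_addn R v.
(* For positive [n] this expression equals [w (n + v) / (n + v)], because
   [1 - v / (n + v) = n / (n + v)]. *)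
have : (w (n + v)%N - b) / n%:R * (1 - v%:R * (n + v)%:R^-1)
    + b * (n + v)%:R^-1 @[n --> \oo] --> c * (1 - v%:R * 0) + b * 0.
  apply: cvgD; last by apply: cvgM kv; exact: cvg_cst.
  apply: cvgM => //; apply: cvgB; first exact: cvg_cst.
  by apply: cvgM kv; exact: cvg_cst.
rewrite !mulr0 subr0 mulr1 addr0; apply: cvg_trans; apply: near_eq_cvg.
apply: filterS (nbhs_infty_gt 0) => n n_gt0 /=.
have n0 : n%:R != 0 :> R by rewrite pnatr_eq0 -lt0n.
have nv0 : n%:R + v%:R != 0 :> R.
  by rewrite -natrD pnatr_eq0 addn_eq0 -leqn0 leqNgt n_gt0.
by rewrite natrD; field; rewrite nv0 n0.
Qed.

Theorem claim1p3 (R : realType) (V : finType) (F : sgraph V)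
    (F_edge : (0 < #|edges F|)%N) (F_noiso : no_isolated_vertex F)
    (n : nat) (le_v_n : (#|V| <= n)%N) :
  (wsat n F)%:R >=
    wsat_density R F * (n%:R - #|V|%:R) + #|edges F|%:R - 1.
Proof.
(* By [F_edge] the constant is the cast of [#|edges F|.-1], which serves as [b]; the index is then
   [n - #|V|], shifted by [#|V|]. *)
rewrite -natrB // -addrA -[X in _ + (_ - X)]/(1%:R) -natrB // subn1.
rewrite -[in leRHS](subnK le_v_n).
apply: (fekete_shift (w := fun n => (wsat n F)%:R)) => [k|k m].
  by rewrite ler_nat wsat_ge_predn.
by rewrite -!natrD ler_nat wsat_subadditive.
Qed.
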